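(* Let $G$ be a finite solvable group acting on a finite set $X$, let $d$ be an HJ-degree of $G$, and let $r\in\mathbb{N}$. Then there exists a positive integer $N$ such that for every $r$-coloring of $X^N$ there exists a uniform $G$-variable word $W$ over $X$ of length $N$ and degree $d^p$, where $p$ is the number of orbits of $G$ in $X$, such that for every $x\in X$ the set $\{W(gx):g\in G\}$ is monochromatic.
   Context: $\mathbb{N}$ denotes the positive integers and $[n]=\{1,\dots,n\}$. An $r$-coloring of a set $Y$ is a map $Y\to[r]$; a subset is monochromatic if the coloring is constant on it. Let $G$ be a finite group acting on a finite set $X$, written $(g,x)\mapsto gx$. Fix distinct variables $\{v_g:g\in G\}$ not belonging to $X$. For a nonempty $H\subseteq G$, an $H$-variable word over $X$ of length $N$ is a sequence $W=(w_i)_{i=1}^N$ with $w_i\in X\cup\{v_h:h\in H\}$ such that each set $F_h=\{i\in[N]:w_i=v_h\}$ ($h\in H$) is nonempty. Its degree is $\sum_{h\in H}|F_h|$. It is uniform if all $|F_h|$, $h\in H$, are equal. For $x\in X$, $W(x)\in X^N$ is obtained by keeping letters $w_i\in X$ and replacing each $v_h$ by $hx$. HJ-degree: if $\{e\}=G_0\trianglelefteq G_1\trianglelefteq\dots\trianglelefteq G_n=G$ is a subnormal series (each $G_{i-1}$ normal in $G_i$) with all factors $G_i/G_{i-1}$ cyclic, and $p_i=|G_i/G_{i-1}|$, then the number $\prod_{i=1}^n p_i^{(p_i-1)\prod_{j>i}p_j}$ is called an HJ-degree of $G$.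
   Formalization: The set X is assumed nonempty: for X empty there are p = 0 orbits, so the required degree is d^0 = 1, while a G-variable word has degree at least |G|, so the claim fails when |G| > 1. *)

(* Defs.v *)
From mathcomp Require Import all_boot all_fingroup all_solvable.

Set Implicit Arguments.
Unset Strict Implicit.
Unset Printing Implicit Defensive.

Section LeftActions.
Variables (gT : finGroupType) (X : finType).
Implicit Types (G : {group gT}) (act : gT -> X -> X).

(* The actions of action.v are right actions; here [act g x] is the left
   action [g x]. Only the values of [act] at elements of G are constrained. *)
Definition is_left_action G act :=
  (forall x, act 1%g x = x) /\
  {in G &, forall g h, forall x, act (g * h)%g x = act g (act h x)}.

Definition left_orbit G act (x : X) : {set X} := [set act g x | g in G].

Definition left_orbits G act : {set {set X}} :=
  [set left_orbit G act x | x : X].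

End LeftActions.

Section VariableWords.
Variables (gT : finGroupType) (X : finType) (N : nat).
Implicit Types (H : {set gT}) (act : gT -> X -> X).

(* [inl x] is the constant letter x, [inr h] is the variable v_h. *)
Implicit Type W : N.-tuple (X + gT).

Definition var_positions W (h : gT) : {set 'I_N} :=
  [set i | tnth W i == inr h].

Definition variable_word H W :=
  (forall i h, tnth W i = inr h -> h \in H) /\
  {in H, forall h, var_positions W h != set0}.

Definition word_degree H W : nat := \sum_(h in H) #|var_positions W h|.

Definition uniform_word H W :=
  {in H &, forall h k, #|var_positions W h| = #|var_positions W k|}.

Definition subst_letter act (x : X) (w : X + gT) : X :=
  match w with inl y => y | inr h => act h x end.

Definition subst_word act W (x : X) : N.-tuple X :=
  [tuple of map (subst_letter act x) W].

End VariableWords.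

Definition monochromatic (Y : finType) (r : nat) (c : Y -> 'I_r) (A : {set Y}) :=
  {in A &, forall u v, c u = c v}.

Section HJDegree.
Variable gT : finGroupType.
Implicit Types (G : {group gT}) (K : nat -> {group gT}).

(* K 0, ..., K n is the series; the values of K beyond n are irrelevant. *)
Definition cyclic_subnormal_series G (n : nat) K :=
  [/\ K 0 = 1%G, K n = G &
      forall i, 1 <= i <= n ->
        (K i.-1 <| K i)%g /\ cyclic (K i / K i.-1)%g].

Definition factor_order K (i : nat) : nat := #|(K i / K i.-1)%g|.

Definition HJ_number (n : nat) K : nat :=
  \prod_(1 <= i < n.+1)
     factor_order K i ^ ((factor_order K i - 1) *
                         \prod_(i.+1 <= j < n.+1) factor_order K j).

Definition HJ_degree G (d : nat) :=
  exists (n : nat) (K : nat -> {group gT}),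
    cyclic_subnormal_series G n K /\ d = HJ_number n K.

End HJDegree.

(* Main.v *)
Require Import Defs.
From mathcomp Require Import all_boot all_fingroup all_solvable.
From mathcomp Require Import zify.

Set Implicit Arguments.
Unset Strict Implicit.
Unset Printing Implicit Defensive.

(* Call two letters interchangeable for a coloring if swapping them, anywhere,
   does not change the color. Plugging variable words into the positions of a
   variable word multiplies degrees, and by Shelah's block argument the plugged
   words can be chosen so that letters with equally colored substitutions become
   interchangeable in the induced coloring; so the required words can be built by
   enlarging the interchangeability relation step by step.
   - For a cyclic group <[a]> of order q acting on itself, make 1, a, ..., a^k
     interchangeable for k = 1, ..., q - 1. Each step uses Ramsey's theorem for
     (q - k)-subsets and costs a factor q, whence the degree q^(q-1).
   - For H normal in G with G / H cyclic of order q, H has q orbits in G. Making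
     each of them interchangeable costs d(H)^q; what remains is the cyclic
     group G / H, whence d(G) = d(H)^q q^(q-1).
   - For an action with p orbits, a word for the regular action makes the letters
     of one orbit interchangeable, whence the degree d^p. *)

(** * Ramsey's theorem for finite sequences *)

Lemma count_pigeonhole (A : eqType) (C : finType) (col : A -> C) (s : seq A)
    (m : nat) :
  0 < #|C| -> #|C| * m <= size s -> exists c, m <= count (fun p => col p == c) s.
Proof.
move=> C0 les; have [->|m0] := posnP m; first by case/card_gt0P: C0 => c _; exists c.
suff /existsP[c hc] : [exists c, m <= count (fun p => col p == c) s] by exists c.
apply: contraT; rewrite negb_exists => /forallP h.
have szE : size s = \sum_(c : C) count (fun p => col p == c) s.
  elim: s {les h} => [|p s IH] /=; first by rewrite big1.
  rewrite big_split /= -IH (bigD1 (col p)) //= eqxx big1 ?addn0 // => c.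
  by rewrite eq_sym => /negbTE->.
suff : size s < #|C| * m by rewrite ltnNge les.
have : \sum_(c : C) (count (fun p => col p == c) s).+1 <= \sum_(c : C) m.
  by apply: leq_sum => c _; move: (h c); rewrite -ltnNge.
rewrite sum_nat_const; apply: leq_trans.
under eq_bigr => c _ do rewrite -addn1.
by rewrite big_split /= -szE sum_nat_const muln1 -[X in X < _]addn0 ltn_add2l.
Qed.

Definition homogeneous (T C : eqType) (f : seq T -> C) (k : nat)
    (t : seq T) (c : C) :=
  forall u, subseq u t -> size u = k -> f u = c.

(* The second components record the color of any [k.+1]-subset starting at the
   first component. *)
Fixpoint end_homogeneous (T C : eqType) (f : seq T -> C) (k : nat)
    (s : seq (T * C)) : Prop :=
  if s is p :: s' then
    homogeneous (fun u => f (p.1 :: u)) k (map fst s') p.2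
      /\ end_homogeneous f k s'
  else True.

Lemma end_homogeneous_filter (T C : eqType) (f : seq T -> C) k P s :
  end_homogeneous f k s -> end_homogeneous f k (filter P s).
Proof.
elim: s => //= p s IH [hp /IH hs]; case: ifP => //= _; split=> // u us.
by apply: hp; apply: subseq_trans us (map_subseq _ (filter_subseq _ _)).
Qed.

Lemma end_homogeneous_mono (T C : eqType) (f : seq T -> C) k s c :
  end_homogeneous f k s -> {in s, forall p, p.2 = c} ->
  homogeneous f k.+1 (map fst s) c.
Proof.
elim: s => [|p s IH] /=; first by move=> _ _ u /eqP->.
move=> [hp hs] hc [|x u] //=; case: eqP => [-> us [sz]|_ us sz].
  by rewrite (hp _ us sz) (hc p (mem_head _ _)).
by apply: IH us sz => // r hr; apply: hc; rewrite inE hr orbT.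
Qed.

Theorem ramsey (C : finType) (k m : nat) : 0 < #|C| ->
  exists N, forall (T : eqType) (f : seq T -> C) (s : seq T), N <= size s ->
    exists t c, [/\ subseq t s, size t = m & homogeneous f k t c].
Proof.
move=> C0; elim: k m => [|k IH] m.
  exists m => T f s les; exists (take m s), (f [::]); split.
  - exact: take_subseq.
  - by rewrite size_takel.
  - by move=> u _ /size0nil->.
(* An end-homogeneous list of length |C| m is enough: by pigeonhole, m of its entries record the
   same color. *)
suff [N hN] : exists N, forall (T : eqType) (f : seq T -> C) (s : seq T),
    N <= size s -> exists y : seq (T * C),
    [/\ subseq (map fst y) s, size y = #|C| * m & end_homogeneous f k y].
  exists N => T f s /(hN T f) [y [ys szy hy]].
  have [c hc] : exists c, m <= count (fun p : T * C => p.2 == c) y.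
    by apply: count_pigeonhole => //; rewrite szy.
  pose z := [seq p <- y | p.2 == c].
  have hz : homogeneous f k.+1 (map fst z) c.
    apply: end_homogeneous_mono; first exact: end_homogeneous_filter.
    by move=> p; rewrite mem_filter => /andP[/eqP].
  exists (take m (map fst z)), c; split.
  - apply: subseq_trans (take_subseq _ _) _; apply: subseq_trans ys.
    exact: map_subseq (filter_subseq _ _).
  - by rewrite size_takel // size_map size_filter.
  - by move=> u us; apply: hz; apply: subseq_trans us (take_subseq _ _).
elim: (#|C| * m) => [|K [N hN]].
  by exists 0 => T f s _; exists [::]; split=> //=; apply: sub0seq.
(* The first point x colors the k-subsets of the rest by u -> f (x :: u); the rest is thinned until
   this color is constant, leaving N points for the inner induction. *)
have [N' hN'] := IH N; exists N'.+1 => T f [|x s] //= les.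
have [t [c [ts szt ht]]] := hN' T (fun u => f (x :: u)) s les.
have [|y [yt szy hy]] := hN T f t; first by rewrite szt.
exists ((x, c) :: y); split=> /=.
- by rewrite eqxx (subseq_trans yt).
- by rewrite szy.
- by split=> // u uy; apply: ht; apply: subseq_trans uy yt.
Qed.

Lemma all2_map_same (A B : Type) (R : B -> B -> bool) (f g : A -> B) s :
  all2 R (map f s) (map g s) = all (fun i => R (f i) (g i)) s.
Proof. by elim: s => //= i s ->. Qed.

(** * Words, plugging words into words, and composition of [HJ] statements *)

Section Words.
Variables (gT : finGroupType) (X : finType).
Implicit Types (T : {set gT}) (act : gT -> X -> X) (R : rel X).
Implicit Types (W : seq (X + gT)) (e : nat).

Definition subst_seq act W (x : X) : seq X := map (subst_letter act x) W.

(** The boolean factor covers both cases: e occurrences for t in T, and no occurrence of variables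
    outside T. *)
Definition evenly_variable T e W :=
  forall t, count_mem (inr t) W = e * (t \in T).

Lemma evenly_variable_mem T e W t : evenly_variable T e W -> inr t \in W -> t \in T.
Proof.
move=> vW; rewrite -has_pred1 has_count vW.
by case: (t \in T); rewrite ?muln0.
Qed.

Definition insensitive (C : Type) (R : rel X) (N : nat) (c : seq X -> C) :=
  forall u v, size u = N -> all2 R u v -> c u = c v.

(* If R0-related letters are interchangeable for c, then some word W identifies
   the colors of R1-related substitutions; each v_t, t in T, occurs e times in W,
   so that its degree is #|T| * e. *)
Definition HJ T act R0 R1 e :=
  forall C : finType, 0 < #|C| -> exists N, forall c : seq X -> C,
    insensitive R0 N c ->
    exists W, [/\ size W = N, evenly_variable T e W &
      forall x y, R1 x y -> c (subst_seq act W x) = c (subst_seq act W y)].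

Lemma insensitive_sub (C : Type) R R' N (c : seq X -> C) :
  subrel R R' -> insensitive R' N c -> insensitive R N c.
Proof.
move=> sR hc u v szu uv; apply: hc => //.
elim: u v {szu} uv => [|x u IH] [|y v] //= /andP[/sR-> /IH].
by [].
Qed.

Lemma insensitive_eq (C : Type) N (c : seq X -> C) : insensitive eq_op N c.
Proof. by move=> u v _ uv; congr c; apply/eqP; rewrite eqseq_all. Qed.

Lemma HJ_sub T act R0 R0' R1 R1' e :
  subrel R0 R0' -> subrel R1' R1 ->
  HJ T act R0 R1 e -> HJ T act R0' R1' e.
Proof.
move=> s0 s1 h C /h[N hN]; exists N => c /(insensitive_sub s0)/hN[W [szW vW hW]].
by exists W; split=> // x y /s1/hW.
Qed.

Definition blocks act (Ws : seq (seq (X + gT))) (u : seq X) : seq X :=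
  flatten [seq subst_seq act p.1 p.2 | p <- zip Ws u].

Lemma size_blocks act Ws u : size u = size Ws ->
  size (blocks act Ws u) = sumn (map size Ws).
Proof.
rewrite /blocks; elim: Ws u => [|W Ws IH] [|x u] //= [] /IH h.
by rewrite size_cat size_map h.
Qed.

(* Shelah's trick: the first word is chosen against the coloring by all
   possible continuations, the remaining ones against the coloring by all
   possible values of the first block. *)
Lemma HJ_blocks T act R e : HJ T act eq_op R e ->
  forall M (C : finType), 0 < #|C| -> exists N, forall c : seq X -> C,
    exists Ws, [/\ size Ws = M, sumn (map size Ws) = N,
      forall W, W \in Ws -> evenly_variable T e W &
      insensitive R M (fun u => c (blocks act Ws u))].
Proof.
move=> h; elim=> [|M IH] C C0.
  exists 0 => c; exists [::]; split=> // u v /size0nil-> .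
  by case: v.
have [|N' hN'] := IH {ffun X -> C}; first by rewrite card_ffun expn_gt0 C0.
have [|N1 hN1] := h {ffun N'.-tuple X -> C}; first by rewrite card_ffun expn_gt0 C0.
exists (N1 + N') => c.
have [W [szW vW hW]] :=
  hN1 (fun w => [ffun t : N'.-tuple X => c (w ++ t)]) (@insensitive_eq _ _ _).
have [Ws [szWs sumWs vWs hWs]] :=
  hN' (fun t => [ffun x => c (subst_seq act W x ++ t)]).
exists (W :: Ws); split=> /=; first by rewrite szWs.
- by rewrite szW sumWs.
- by move=> W'; rewrite inE => /predU1P[->|/vWs].
move=> [|x u] [|y v] //= [szu] /andP[xy uv];
  rewrite /blocks /= -/(blocks _ _ _) -/(blocks _ _ _).
have szb : size (blocks act Ws u) == N' by rewrite size_blocks ?sumWs // szu.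
have /ffunP/(_ (Tuple szb)) := hW x y xy; rewrite !ffunE /= => ->.
by have /ffunP/(_ y) := hWs u v szu uv; rewrite !ffunE.
Qed.

Lemma count_variables T e W (P : pred gT) : evenly_variable T e W ->
  count (fun w => if w is inr a then P a else false) W = e * #|[set a in T | P a]|.
Proof.
move=> vW.
have -> : count (fun w => if w is inr a then P a else false) W
    = \sum_a P a * count_mem (inr a) W.
  elim: W {vW} => [|w W IH] /=; first by rewrite big1 // => a _; rewrite muln0.
  rewrite IH; under [RHS]eq_bigr => a _ do rewrite mulnDr.
  rewrite big_split /=; congr (_ + _); case: w => [y|b];
    first by rewrite big1 // => a _; rewrite muln0.
  rewrite (bigD1 b) //= eqxx muln1 big1 ?addn0 // => a ab.
  by case: eqP => [[ba]|]; [rewrite ba eqxx in ab | rewrite muln0].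
under eq_bigr => a _ do rewrite vW mulnCA.
rewrite -big_distrr /= -sum1_card [in RHS]big_mkcond /=; congr (_ * _).
by apply: eq_bigr => a _; rewrite inE mulnb andbC; case: (_ && _).
Qed.

Definition mul_letter (a : gT) (w : X + gT) : X + gT :=
  if w is inr h then inr (h * a)%g else w.

(** Replacing each v_h of W by v_(ha) gives a block whose value at x is W(ax), as required at a
    position carrying v_a. *)
Definition plug_letter act W (u : X + gT) : seq (X + gT) :=
  match u with
  | inl y => map inl (subst_seq act W y)
  | inr a => map (mul_letter a) W
  end.

Definition plug act (Ws : seq (seq (X + gT))) (U : seq (X + gT)) :=
  flatten [seq plug_letter act p.1 p.2 | p <- zip Ws U].

Lemma size_plug act Ws U : size U = size Ws ->
  size (plug act Ws U) = sumn (map size Ws).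
Proof.
rewrite /plug; elim: Ws U => [|W Ws IH] [|[y|a] U] //= [] /IH h;
  by rewrite size_cat !size_map h.
Qed.

Lemma subst_plug T1 T2 act e1 e2 Ws U x :
  {in T1 & T2, forall h a y, act (h * a)%g y = act h (act a y)} ->
  (forall W, W \in Ws -> evenly_variable T1 e1 W) ->
  evenly_variable T2 e2 U ->
  size U = size Ws ->
  subst_seq act (plug act Ws U) x = blocks act Ws (subst_seq act U x).
Proof.
move=> actM vWs vU.
have {vU} : forall a, inr a \in U -> a \in T2 by move=> a;
  apply: evenly_variable_mem vU.
rewrite /plug /blocks; elim: Ws U vWs => [|W Ws IH] [|u U] //= vWs vU [szU].
rewrite {1}/subst_seq map_cat -/(subst_seq _ _ _) -/(subst_seq _ _ _) IH //;
  first last.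
- by move=> a aU; apply: vU; rewrite inE aU orbT.
- by move=> W' hW'; apply: vWs; rewrite inE hW' orbT.
congr (_ ++ _); case: u vU => [y|a] vU /=.
  by rewrite /subst_seq -map_comp map_id_in.
rewrite /subst_seq -map_comp; apply/eq_in_map => -[y|h] //= hW.
rewrite actM //; last by apply: vU; rewrite inE eqxx.
exact: evenly_variable_mem (vWs W (mem_head _ _)) hW.
Qed.

(** In a block plugged at v_a, the variable v_t comes from v_h with t = h a, that is h = t a^-1. *)
Lemma count_plug T1 act e1 Ws U t :
  (forall W, W \in Ws -> evenly_variable T1 e1 W) ->
  size U = size Ws ->
  count_mem (inr t) (plug act Ws U)
    = e1 * count (fun w => if w is inr a then (t * a^-1)%g \in T1 else false) U.
Proof.
rewrite /plug; elim: Ws U => [|W Ws IH] [|u U] //= vWs; first by rewrite muln0.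
move=> [szU]; rewrite count_cat IH //; last first.
  by move=> W' hW'; apply: vWs; rewrite inE hW' orbT.
rewrite mulnDr; congr (_ + _); case: u => [y|a] /=.
  by rewrite muln0; apply/eqP; rewrite -leqn0 leqNgt -has_count has_pred1;
    apply/mapP => -[].
rewrite -(vWs W (mem_head _ _)) count_map; apply: eq_count => -[y|h] //=.
by apply/eqP/eqP => -[]; [move<-; rewrite mulgK | move->; rewrite mulgKV].
Qed.

(** The blocks from [HJ_blocks] induce an [R1]-insensitive coloring, against which the outer word is
    chosen. Each of the k factorizations t = h a, with h in T1 and a in T2, contributes e1 * e2
    occurrences of v_t. *)
Lemma HJ_compose T1 T2 T act R1 R2 e1 e2 k :
  {in T1 & T2, forall h a y, act (h * a)%g y = act h (act a y)} ->
  (forall t, #|[set a in T2 | (t * a^-1)%g \in T1]| = k * (t \in T)) ->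
  HJ T1 act eq_op R1 e1 -> HJ T2 act R1 R2 e2 ->
  HJ T act eq_op R2 (k * e1 * e2).
Proof.
move=> actM hk h1 h2 C C0; have [M hM] := h2 C C0.
have [N hN] := HJ_blocks h1 M C0.
exists N => c _; have [Ws [szWs sumWs vWs hWs]] := hN c.
have [U [szU vU hU]] := hM _ hWs.
have szUW : size U = size Ws by rewrite szU.
exists (plug act Ws U); split; first by rewrite size_plug.
  by move=> t; rewrite (count_plug _ _ vWs) // (count_variables _ vU) hk
    (mulnCA e2) mulnCA !mulnA.
by move=> x y /hU; rewrite !(subst_plug _ actM vWs vU).
Qed.

Lemma HJ_compose_group (G : {group gT}) act R1 R2 e1 e2 :
  is_left_action G act ->
  HJ G act eq_op R1 e1 -> HJ G act R1 R2 e2 ->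
  HJ G act eq_op R2 (#|G| * e1 * e2).
Proof.
move=> [_ actM]; apply: HJ_compose => // t.
have [tG|tG] := boolP (t \in G).
  by rewrite muln1; apply: eq_card => a; rewrite inE;
    case: (boolP (a \in G)) => // aG; rewrite groupM ?groupV.
rewrite muln0; apply: eq_card0 => a; rewrite inE.
by case: (boolP (a \in G)) => // aG; rewrite groupMr ?groupV // (negbTE tG).
Qed.

End Words.

(** * Cyclic groups acting on themselves *)

Lemma mem_window (T : eqType) (x0 : T) (t : seq T) m n h :
  uniq t -> m + n <= size t -> h < size t ->
  (nth x0 t h \in take n (drop m t)) = (m <= h < m + n).
Proof.
move=> ut le_mn lt_h; set u := take n (drop m t).
have szu : size u = n by rewrite size_takel // size_drop; lia.
have nu i : i < n -> nth x0 u i = nth x0 t (m + i)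
  by move=> lt_i; rewrite nth_take // nth_drop.
apply/(nthP x0)/andP => [[i]|[le_m lt_m]].
  rewrite szu => lt_i; rewrite nu // => /eqP; rewrite nth_uniq //; last first.
    by apply: leq_trans le_mn; rewrite ltn_add2l.
  by move/eqP<-; rewrite leq_addr ltn_add2l.
have lt_i : h - m < n by rewrite -(ltn_add2l m) subnKC.
by exists (h - m); rewrite ?szu // nu // subnKC.
Qed.

Lemma index_window (T : eqType) (x0 : T) (t : seq T) m n h :
  uniq t -> m + n <= size t -> m <= h < m + n ->
  index (nth x0 t h) (take n (drop m t)) = h - m.
Proof.
move=> ut le_mn /andP[le_m lt_m]; set u := take n (drop m t).
have szu : size u = n by rewrite size_takel // size_drop; lia.
have lt_i : h - m < n by rewrite -(ltn_add2l m) subnKC.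
have -> : nth x0 t h = nth x0 u (h - m) by rewrite nth_take // nth_drop subnKC.
by rewrite index_uniq ?szu // take_uniq // drop_uniq.
Qed.

Section Regular.
Variable gT : finGroupType.
Implicit Types (G : {group gT}) (a : gT).

Definition HJ_regular (G : {group gT}) e :=
  HJ G (@mulg gT) eq_op (fun x y => (x \in G) && (y \in G)) e.

Definition low_powers a k : pred gT := mem [seq (a ^+ i)%g | i <- iota 0 k.+1].

Lemma low_powersP a k x :
  reflect (exists2 i, i <= k & x = (a ^+ i)%g) (low_powers a k x).
Proof.
by apply: (iffP mapP) => -[i]; rewrite ?mem_iota => hi ->; exists i;
  rewrite ?mem_iota.
Qed.

Definition low_rel a k : rel gT :=
  fun x y => (x == y) || (low_powers a k x && low_powers a k y).

(* The letters 1, a, ..., a^k being interchangeable, a word is determined by the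
   positions of the other n = #[a] - k - 1 letters. When the variables v_1, v_a,
   v_(a^2), ... are placed at positions p_0 < p_1 < ..., replacing them by their
   product with a^j, j <= k + 1, puts those letters at n consecutive p_i's. *)
Lemma HJ_cycle_step a k : k.+1 < #[a]%g ->
  HJ <[a]>%g (@mulg gT) (low_rel a k) (low_rel a k.+1) 1.
Proof.
move=> ltk C C0; set q := #[a]%g; set n := q - k.+1.
have [N hN] := ramsey n q C0; exists N => c hc.
(* An n-subset u encodes the word with a^(k+1), ..., a^(q-1) at the positions of u, in increasing
   order, and 1 elsewhere. *)
pose spell (u : seq nat) :=
  [seq (if i \in u then a ^+ (k.+1 + index i u) else 1)%g | i <- iota 0 N].
have [|t [c0 [tN szt ht]]] := hN nat (fun u => c (spell u)) (iota 0 N).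
  by rewrite size_iota.
have ut : uniq t by apply: subseq_uniq tN (iota_uniq _ _).
pose W : seq (gT + gT) :=
  [seq (if i \in t then inr (a ^+ (index i t))%g else inl 1%g) | i <- iota 0 N].
suff hW j : j <= k.+1 -> c (subst_seq (@mulg gT) W (a ^+ j)%g) = c0.
  exists W; split; first by rewrite size_map size_iota.
    move=> g; rewrite mul1n count_map;
      case: (boolP (g \in _)) => [/cyclePmin[h lt_h ->]|gG].
      transitivity (count_mem (nth 0 t h) (iota 0 N)); last first.
        by rewrite count_uniq_mem ?iota_uniq // (mem_subseq tN) // mem_nth ?szt.
      apply: eq_in_count => i _ /=; case: ifP => it; last first.
        by apply/esym/negbTE/eqP => ie; rewrite ie mem_nth ?szt in it.
      rewrite -[in RHS](nth_index 0 it) nth_uniq ?index_mem ?szt //.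
      have lt_i : index i t < q by rewrite -szt index_mem.
      apply/eqP/eqP => [[/eqP]|->] //.
      by rewrite eq_expg_mod_order !modn_small // => /eqP.
    apply/eqP; rewrite -leqn0 leqNgt -has_count; apply/hasPn => i _ /=.
    case: ifP => // it; apply/eqP => -[ge].
    by rewrite -ge mem_cycle in gG.
  move=> x y /orP[/eqP->//|/andP[/low_powersP[i hi ->] /low_powersP[j hj ->]]].
  by rewrite !hW.
(* At p_h the word W(a^j) has a^(h+j), which is not low exactly when k + 1 <= h + j < q, that is m
   <= h < m + n. *)
move=> le_j; pose m := k.+1 - j; pose u := take n (drop m t).
have le_mn : m + n <= size t.
  by rewrite szt /n /m /q; lia.
rewrite -(ht u); first last.
- by rewrite size_takel // size_drop; lia.
- exact: subseq_trans (take_subseq _ _) (drop_subseq _ _).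
apply: hc; first by rewrite !size_map size_iota.
rewrite /subst_seq /W /spell -map_comp all2_map_same; apply/allP => i _ /=.
have low1 : low_powers a k 1%g by apply/low_powersP; exists 0.
rewrite /low_rel; case: (boolP (i \in t)) => it /=; last first.
  suff /negbTE-> : i \notin u by rewrite eqxx.
  by apply: contra it => /mem_take/mem_drop.
set h := index i t; have lt_h : h < size t by rewrite index_mem.
rewrite -(nth_index 0 it) -/h mem_window // -expgD.
case: ifP => [/andP[le_m lt_m]|not_m].
  rewrite index_window ?le_m //.
  suff -> : k.+1 + (h - m) = h + j by rewrite eqxx.
  by rewrite /m; lia.
rewrite low1 andbT; apply/orP; right; apply/low_powersP.
(* Before the window the exponent h + j is at most k. After it the exponent wraps around to h + j -
   q, again at most k because h < q and j <= k + 1. *)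
have [le_q|lt_q] := leqP q (h + j); last by exists (h + j) => //;
  rewrite /m /n in not_m; lia.
exists (h + j - q); first by rewrite szt in lt_h; lia.
by rewrite -{1}(subnK le_q) expgD expg_order mulg1.
Qed.



Lemma mulg_left_action G : is_left_action G (@mulg gT).
Proof. by split=> [x|g h _ _ x]; rewrite ?mul1g ?mulgA. Qed.

(** The first step starts from equality, since [low_rel a 0] only relates equal letters; each later
    composition multiplies the number of occurrences by the order of a. *)
Lemma HJ_cycle_low a k : k.+1 < #[a]%g ->
  HJ <[a]>%g (@mulg gT) eq_op (low_rel a k.+1) (#[a]%g ^ k).
Proof.
elim: k => [|k IH] ltk.
  apply: HJ_sub (HJ_cycle_step ltk) => // x y.
  case/orP=> // /andP[/low_powersP[i + ->] /low_powersP[j + ->]].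
  by rewrite !leqn0 => /eqP-> /eqP->.
rewrite expnS -[_ * _]muln1.
exact: (HJ_compose_group (mulg_left_action [group of <[a]>%g])) (IH (ltnW ltk))
  (HJ_cycle_step ltk).
Qed.

Lemma HJ_regular1 : HJ_regular (1%G : {group gT}) 1.
Proof.
move=> C _; exists 1 => c _; exists [:: inr 1%g]; split=> //.
  move=> t /=; rewrite addn0 mul1n inE.
  by congr nat_of_bool; apply/eqP/eqP => [[]|->].
by move=> x y; rewrite !inE => /andP[/eqP-> /eqP->].
Qed.

(** For order q > 1, stopping at the exponent q - 1 relates all of G, with e = q^(q-2); the trivial
    group has e = 1. *)
Lemma HJ_regular_cyclic G : cyclic G ->
  exists2 e, #|G| * e = #|G| ^ (#|G| - 1) & HJ_regular G e.
Proof.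
case/cyclicP=> a defG; case: (ltnP 1 #|G|) => [G1|leG1]; last first.
  have G1 : #|G| = 1 by apply/eqP; rewrite eqn_leq leG1 cardG_gt0.
  exists 1; first by rewrite G1.
  have -> : G = 1%G by apply: val_inj; apply/eqP; rewrite [_ == _]trivg_card1 G1.
  exact: HJ_regular1.
have oa : #|G| = #[a]%g by rewrite defG.
exists (#|G| ^ (#|G| - 2)).
  by rewrite -expnS; congr (_ ^ _); lia.
rewrite /HJ_regular oa defG; apply: HJ_sub (HJ_cycle_low (k :=
  #[a]%g - 2) _) => //; last first.
  by lia.
have -> : (#[a]%g - 2).+1 = #[a]%g.-1 by lia.
have low x : x \in <[a]>%g -> low_powers a #[a]%g.-1 x.
  by case/cyclePmin=> i lt_i ->; apply/low_powersP; exists i => //; lia.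
by move=> x y /andP[/low hx /low hy]; rewrite /low_rel hx hy orbT.
Qed.

(** * From the regular action to the orbits of an arbitrary action *)

Section Orbits.
Variables (X : finType) (G : {group gT}) (act : gT -> X -> X) (e : nat).
Hypotheses (actG : is_left_action G act) (hG : HJ_regular G e).
Implicit Types (x y : X).

Definition orbit_rel (xs : seq X) : rel X := fun x y =>
  (x == y) ||
  has (fun x0 => (x \in left_orbit G act x0) && (y \in left_orbit G act x0)) xs.

Lemma left_orbit_act g x x0 : g \in G ->
  x \in left_orbit G act x0 -> act g x \in left_orbit G act x0.
Proof.
move=> gG /imsetP[h hh ->]; rewrite -actG.2 //.
by apply: imset_f; rewrite groupM.
Qed.

Lemma left_orbit_refl x : x \in left_orbit G act x.
Proof. by apply/imsetP; exists 1%g => //; rewrite actG.1. Qed.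

(** A word for the regular action is carried to X by g -> g x0, which handles the new orbit. Letters
    of an earlier orbit stay in it under G, so their substitutions remain interchangeable for the
    coloring. *)
Lemma HJ_orbit_step xs x0 : HJ G act (orbit_rel xs) (orbit_rel (x0 :: xs)) e.
Proof.
move=> C C0; have [N hN] := hG C0; exists N => c hc.
have [W [szW vW hW]] := hN (fun u => c (map (act^~ x0) u)) (@insensitive_eq _ _ _ _).
pose move_letter (w : gT + gT) : X + gT :=
  match w with inl g => inl (act g x0) | inr h => inr h end.
have substW g : g \in G ->
    subst_seq act (map move_letter W) (act g x0)
    = map (act^~ x0) (subst_seq (@mulg gT) W g).
  move=> gG; rewrite /subst_seq -!map_comp; apply/eq_in_map => -[y|h] //= hW'.
  by rewrite actG.2 // (evenly_variable_mem vW).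
have vW' : evenly_variable G e (map move_letter W).
  by move=> t; rewrite -vW count_map; apply: eq_count => -[y|h].
exists (map move_letter W); split=> //; first by rewrite size_map.
move=> x y; rewrite /orbit_rel /= orbCA.
case/orP=> [/andP[/imsetP[g gG ->] /imsetP[h hh ->]]|xy].
  by rewrite !substW //; apply: hW; rewrite gG.
apply: hc; first by rewrite !size_map.
rewrite all2_map_same; apply/allP => -[z|h] /= hW'; first by rewrite /orbit_rel eqxx.
have hh : h \in G by apply: evenly_variable_mem vW' hW'.
case/orP: xy => [/eqP->|/hasP[x1 x1s /andP[hx hy]]];
  first by rewrite /orbit_rel eqxx.
by apply/orP; right; apply/hasP; exists x1; rewrite ?left_orbit_act.
Qed.

Lemma HJ_orbits x0 xs :
  HJ G act eq_op (orbit_rel (x0 :: xs)) (#|G| ^ size xs * e ^ (size xs).+1).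
Proof.
elim: xs x0 => [|x1 xs IH] x0.
  rewrite mul1n expn1; apply: HJ_sub (HJ_orbit_step [::] x0) => //.
  by move=> x y; rewrite /orbit_rel /= orbF.
have := HJ_compose_group actG (IH x1) (HJ_orbit_step (x1 :: xs) x0).
by rewrite /= [in X in _ -> X]expnS [in X in _ -> X](expnSr e) !mulnA.
Qed.

End Orbits.
End Regular.

(** * Extensions by cyclic quotients and induction along the series *)

Section Series.
Variable gT : finGroupType.
Implicit Types (G H : {group gT}).

Lemma mem_repr_quotient G H (z : coset_of H) : (H <| G)%g ->
  z \in (G / H)%g -> repr z \in G.
Proof.
move=> nHG zGH; rewrite -(quotientGK nHG) mem_morphpre ?repr_coset_norm //.
by rewrite /= coset_reprK.
Qed.

(** The orbits of H under left multiplication are the cosets H x, and each coset in G / H contains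
    its chosen representative. *)
Lemma orbit_rel_quotient G H (x y : gT) : (H <| G)%g ->
  x \in G -> y \in G -> coset H x = coset H y ->
  orbit_rel H (@mulg gT) [seq repr z | z : coset_of H in (G / H)%g] x y.
Proof.
move=> nHG xG yG xy; have sGN := normal_norm nHG.
have orb w : w \in G -> w \in left_orbit H (@mulg gT) (repr (coset H w)).
  move=> wG; have wN := subsetP sGN w wG.
  have [h hH wE] := kercoset_rcoset wN (repr_coset_norm (coset H w))
    (esym (coset_reprK _)).
  by apply/imsetP; exists h.
apply/orP; right; apply/hasP; exists (repr (coset H x)).
  by apply: image_f; rewrite mem_quotient.
by rewrite orb // xy orb.
Qed.

(** A word over G / H is lifted letter by letter through [repr]. Its value at x in G agrees, up to
    H-cosets, with the lift of the value at the coset of x, and the coloring does not see the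
    difference. *)
Lemma HJ_quotient_lift G H e : (H <| G)%g -> HJ_regular (G / H)%G e ->
  HJ [set repr z | z : coset_of H in (G / H)%g] (@mulg gT)
    (orbit_rel H (@mulg gT) [seq repr z | z : coset_of H in (G / H)%g])
    (fun x y => (x \in G) && (y \in G)) e.
Proof.
move=> nHG hQ C C0; have [N hN] := hQ C C0; exists N => c hc.
have sGN := normal_norm nHG.
have [U [szU vU hU]] :=
  hN (fun u => c [seq repr z | z : coset_of H <- u]) (@insensitive_eq _ _ _ _).
pose lift (w : coset_of H + coset_of H) : gT + gT :=
  match w with inl z => inl (repr z) | inr z => inr (repr z) end.
have repr_inj : injective (fun z : coset_of H => repr z).
  by apply: (can_inj (g := coset H)) => z; apply: coset_reprK.
exists (map lift U); split; first by rewrite size_map.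
  move=> t; rewrite count_map; case: imsetP => [[z zGH ->]|tA].
    have := vU z; rewrite zGH => <-.
    apply: eq_count => -[y|z'] //=.
    by apply/eqP/eqP => [[/repr_inj->]|[->]].
  rewrite muln0; apply/eqP; rewrite -leqn0 leqNgt -has_count;
    apply/hasPn => -[y|z] //= zU.
  apply/eqP => -[tz]; case: tA; exists z => //.
  exact: evenly_variable_mem vU zU.
suff hx x : x \in G -> c (subst_seq (@mulg gT) (map lift U) x)
    = c [seq repr z | z : coset_of H <-
            subst_seq (@mulg (coset_of H)) U (coset H x)].
  move=> x y /andP[xG yG]; rewrite !hx //; apply: hU.
  by rewrite !mem_quotient.
move=> xG; apply: hc; first by rewrite !size_map.
rewrite /subst_seq -!map_comp all2_map_same; apply/allP => -[z|z] zU /=.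
  by rewrite /orbit_rel eqxx.
have zGH : z \in (G / H)%g by apply: evenly_variable_mem vU zU.
have xN := subsetP sGN x xG.
apply: orbit_rel_quotient => //.
- by apply: groupM => //; apply: mem_repr_quotient.
- by apply: (@mem_repr_quotient G H (z * coset H x)%g) => //;
    apply: groupM => //; apply: mem_quotient.
- by rewrite morphM ?repr_coset_norm //= (coset_reprK z)
    (coset_reprK (z * coset H x)%g).
Qed.

(** Each t in G is uniquely h a with h in H and a a representative; this gives k = 1 in
    [HJ_compose]. *)
Lemma card_transversal_fiber G H (t : gT) : (H <| G)%g ->
  #|[set a in [set repr z | z : coset_of H in (G / H)%g] | (t * a^-1)%g \in H]|
    = (t \in G).
Proof.
move=> nHG; have sGN := normal_norm nHG; have sHG := normal_sub nHG.
have [tG|tG] := boolP (t \in G); last first.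
  apply: eq_card0 => a; rewrite !inE; apply/negP => /andP[/imsetP[z zGH ->]].
  move/(subsetP sHG); rewrite groupMr ?groupV ?(mem_repr_quotient nHG) //.
  exact/negP.
have tN := subsetP sGN t tG.
apply/eqP/cards1P; exists (repr (coset H t)); apply/setP => a; rewrite !inE.
apply/andP/eqP => [[/imsetP[z zGH ->]] tz|->]; last first.
  split; first by apply: imset_f; rewrite mem_quotient.
  have [h hH ht] := kercoset_rcoset tN (repr_coset_norm (coset H t))
    (esym (coset_reprK _)).
  by rewrite {1}ht mulgK.
congr (repr (_ : coset_of H)); rewrite -[LHS]coset_reprK.
by rewrite -[in RHS](mulgKV (repr z) t) [RHS]mkerl ?ker_coset ?repr_coset_norm //.
Qed.

Lemma HJ_regular_extension G H e : (H <| G)%g -> cyclic (G / H)%g ->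
  HJ_regular H e ->
  exists2 e', #|G| * e' = (#|H| * e) ^ #|(G / H)%g|
                            * #|(G / H)%g| ^ (#|(G / H)%g| - 1)
            & HJ_regular G e'.
Proof.
move=> nHG cGH hH; have [f fE hQ] := HJ_regular_cyclic cGH.
have hL := HJ_quotient_lift nHG hQ.
have szxs : size [seq repr z | z : coset_of H in (G / H)%g] = #|(G / H)%g|.
  by rewrite size_map -cardE.
case: [seq repr z | z : coset_of H in (G / H)%g] szxs hL
  => [/esym/eqP|x0 xs szxs hL].
  by rewrite -leqn0 leqNgt cardG_gt0.
have hO := HJ_orbits (mulg_left_action H) hH x0 xs.
(* Here [size xs] is q - 1 with q = |G / H|, so multiplying by |G| = |H| q yields (|H| e)^q times q
   f. *)
exists (1 * (#|H| ^ size xs * e ^ (size xs).+1) * f); last first.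
  apply: HJ_compose hO hL => [h a _ _ y|t]; first by rewrite mulgA.
  by rewrite mul1n card_transversal_fiber.
have GE : #|G| = #|H| * #|(G / H)%g|.
  by rewrite (card_quotient (normal_norm nHG)) Lagrange ?normal_sub.
rewrite -fE GE -szxs /= expnMn (expnS #|H|).
by rewrite mul1n mulnACA !mulnA.
Qed.

(** A new top factor q multiplies every earlier exponent by q, while its own exponent is q - 1 times
    an empty product. *)
Lemma HJ_number_recr n (K : nat -> {group gT}) :
  HJ_number n.+1 K = HJ_number n K ^ factor_order K n.+1
    * factor_order K n.+1 ^ (factor_order K n.+1 - 1).
Proof.
rewrite /HJ_number big_nat_recr //= [X in _ * _ ^ (_ * X)]big_geq // muln1;
  congr (_ * _).
rewrite (big_morph (expn^~ _) (fun x y => expnMn x y _) (exp1n _)).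
apply: eq_big_nat => i /andP[_ lt_i].
by rewrite big_nat_recr //= mulnA expnM.
Qed.

Lemma HJ_number_gt0 n (K : nat -> {group gT}) : 0 < HJ_number n K.
Proof. by apply: prodn_gt0 => i; rewrite expn_gt0 cardG_gt0. Qed.

Lemma HJ_regular_series G n K : cyclic_subnormal_series G n K ->
  exists2 e, #|G| * e = HJ_number n K & HJ_regular G e.
Proof.
case=> K0 <- hK; elim: n hK => [|n IH] hK.
  by rewrite K0; exists 1; [rewrite cards1 /HJ_number big_geq | apply: HJ_regular1].
have [|e eE he] := IH; first by move=> i /andP[i0 le_i]; apply: hK; rewrite i0 leqW.
have [|nK cK] := hK n.+1; first by rewrite leqnn.
have [e' e'E he'] := HJ_regular_extension nK cK he.
by exists e'; rewrite // HJ_number_recr e'E eE.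
Qed.

End Series.

(** * Orbit representatives, tuples and the final word *)

Lemma orbit_reprs (gT : finGroupType) (G : {group gT}) (X : finType)
    (act : gT -> X -> X) : is_left_action G act ->
  exists xs : seq X, size xs = #|left_orbits G act| /\
    forall x g, g \in G -> orbit_rel G act xs x (act g x).
Proof.
move=> actG; have [x0 _|X0] := pickP (mem X); last first.
  exists [::]; split=> [|x]; last by have := X0 x.
  by apply/esym/eq_card0 => B; apply/imsetP => -[x]; have := X0 x.
(* The default [x0] is only for the empty set, which is not an orbit. *)
pose rep (B : {set X}) := odflt x0 [pick x in B].
exists [seq rep B | B in left_orbits G act]; split=> [|x g gG].
  by rewrite size_map -cardE.
have act1 := left_orbit_refl actG.
apply/orP; right; apply/hasP; exists (rep (left_orbit G act x)).
  by apply: image_f; apply: imset_f.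
have : rep (left_orbit G act x) \in left_orbit G act x.
  by rewrite /rep; case: pickP => //= /(_ x); rewrite act1.
case/imsetP=> h hG ->.
have orb k : k \in G -> act k x \in left_orbit G act (act h x).
  move=> kG; apply/imsetP; exists (k * h^-1)%g; first by rewrite groupM ?groupV.
  by rewrite -actG.2 ?groupM ?groupV // mulgKV.
by rewrite -{1}(actG.1 x) !orb.
Qed.

(** Passes from colorings of tuples to colorings of lists; a letter of X pads the lists that are too
    short. *)
Lemma tuple_coloring (X : finType) (N : nat) (C : Type) (c : N.-tuple X -> C) :
  0 < #|X| -> exists c' : seq X -> C, forall t : N.-tuple X, c' t = c t.
Proof.
case/card_gt0P=> x0 _; exists (fun s => c [tuple nth x0 s i | i < N]) => t.
by congr c; apply: eq_from_tnth => i; rewrite tnth_mktuple -tnth_nth.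
Qed.

Lemma card_var_positions (gT : finGroupType) (X : finType) (N : nat)
    (W : N.-tuple (X + gT)) h :
  #|var_positions W h| = count_mem (inr h) W.
Proof.
by rewrite -sum1_count big_tuple -sum1_card; apply: eq_bigl => i; rewrite inE.
Qed.

Theorem theorem1p6 (gT : finGroupType) (G : {group gT}) (X : finType)
    (act : gT -> X -> X) (d r : nat) :
  solvable G ->
  0 < #|X| ->
  is_left_action G act ->
  HJ_degree G d ->
  0 < r ->
  exists N : nat, 0 < N /\
    forall c : N.-tuple X -> 'I_r,
      exists W : N.-tuple (X + gT),
        [/\ variable_word G W,
            uniform_word G W,
            word_degree G W = d ^ #|left_orbits G act| &
            forall x : X,
              monochromatic c [set subst_word act W (act g x) | g in G]].
Proof.
move=> _ X0 actG [n [K [hK ->]]] r0.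
have [e eE he] := HJ_regular_series hK.
have [[|x0 xs] [szxs hxs]] := orbit_reprs actG.
  case/card_gt0P: X0 => x _; have: left_orbit G act x \in left_orbits G act
    by apply: imset_f.
  by rewrite (card0_eq (esym szxs)).
have hO := HJ_orbits actG he x0 xs; set f := _ * _ in hO.
have fE : #|G| * f = HJ_number n K ^ #|left_orbits G act|.
  rewrite -szxs -eE /f /= expnMn (expnS #|G|).
  by rewrite mulnA.
(* Every variable will occur f times, so f > 0 makes all its position sets nonempty. *)
have f0 : 0 < f.
  have : 0 < #|G| * f by rewrite fE expn_gt0 HJ_number_gt0.
  by rewrite muln_gt0 => /andP[].
have [|N hN] := hO 'I_r; first by rewrite card_ord.
exists N; split.
  (* The word for a constant coloring has length N and contains v_1 f times, hence N > 0. *)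
  have [W [<- vW _]] := hN (fun=> Ordinal r0) (@insensitive_eq _ _ _ _).
  apply: leq_trans (count_size (pred1 (inr 1%g)) W).
  by rewrite vW group1 muln1.
move=> c; have [c' c'E] := tuple_coloring c X0.
have [W [szW vW hW]] := hN c' (@insensitive_eq _ _ _ _).
move/eqP: szW => szW; pose Wt := Tuple szW.
have posE h : #|var_positions Wt h| = f * (h \in G) by rewrite card_var_positions vW.
exists Wt; split.
- split=> [i h hi|h hG].
    by apply: evenly_variable_mem vW _; rewrite -hi (mem_tnth i Wt).
  by rewrite -card_gt0 posE hG muln1.
- by move=> h k hG kG; rewrite !posE hG kG.
- rewrite /word_degree -fE -sum_nat_const; apply: eq_bigr => h hG.
  by rewrite posE hG muln1.
- move=> x u v /imsetP[g gG ->] /imsetP[h hG ->].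
  have cE k : k \in G -> c (subst_word act Wt (act k x)) = c' (subst_seq act W x).
    by move=> kG; rewrite -c'E -(hW _ _ (hxs x k kG)).
  by rewrite !cE.
Qed.
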